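(* Let $G_1$ and $G_2$ be two graphs. Then $G_1 \cup G_2$ is a $\{2\}$-Roman graph if and only if $G_1$ and $G_2$ are both $\{2\}$-Roman graphs.
   Context: All graphs are finite, undirected and simple, with nonempty vertex set. For a graph $G=(V,E)$, a function $f:V\to\{0,1,2\}$ is a Roman $\{2\}$-dominating function of $G$ if for every $v\in V$ with $f(v)=0$, either $v$ has a neighbor $u$ with $f(u)=2$, or $v$ has two distinct neighbors $x,y$ with $f(x)=f(y)=1$. The weight of $f$ is $\sum_{v\in V}f(v)$, and $\gamma_{\{R2\}}(G)$ is the minimum weight of a Roman $\{2\}$-dominating function of $G$. $\gamma(G)$ is the domination number of $G$. One always has $\gamma_{\{R2\}}(G)\le 2\gamma(G)$, and $G$ is a $\{2\}$-Roman graph if $\gamma_{\{R2\}}(G)=2\gamma(G)$. The union $G_1\cup G_2$ of two (vertex-disjoint) graphs is the graph with vertex set $V(G_1)\cup V(G_2)$ and edge set $E(G_1)\cup E(G_2)$. *)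

(* Defs.v *)
From HB Require Import structures.
From mathcomp Require Import all_boot.

Set Implicit Arguments.
Unset Strict Implicit.
Unset Printing Implicit Defensive.

Record sgraph := SGraph {
  vertex :> finType;
  edge : rel vertex;
  edge_sym : symmetric edge;
  edge_irrefl : irreflexive edge;
  vertex_gt0 : 0 < #|vertex|
}.

Section Domination.

Variable G : sgraph.

Definition dominating (D : {set G}) : bool :=
  [forall v, (v \notin D) ==> [exists u, (u \in D) && edge v u]].

Lemma dominatingT : dominating [set: G].
Proof. by apply/forallP=> v; rewrite inE. Qed.

Definition domination_number : nat :=
  #|[arg min_(D < [set: G] | dominating D) #|D|]|.

Definition roman2_dominating (f : {ffun G -> 'I_3}) : bool :=
  [forall v, (f v == 0 :> nat) ==>
     ([exists u, edge v u && (f u == 2 :> nat)]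
      || [exists x, exists y, [&& x != y, edge v x, edge v y,
                                  f x == 1 :> nat & f y == 1 :> nat]])].

Definition weight (f : {ffun G -> 'I_3}) : nat := \sum_(v : G) f v.

Lemma roman2_dominating_max : roman2_dominating [ffun => ord_max].
Proof. by apply/forallP=> v; rewrite ffunE. Qed.

Definition roman2_domination_number : nat :=
  weight [arg min_(f < [ffun => ord_max] | roman2_dominating f) weight f].

(* The starting points of the two arg mins are admissible, so both numbers
   are genuine minima. *)
Lemma domination_numberP :
  (exists2 D, dominating D & #|D| = domination_number) /\
  (forall D, dominating D -> domination_number <= #|D|).
Proof.
rewrite /domination_number; case: arg_minnP => [|D domD minD].
  exact: dominatingT.
by split; [exists D | exact: minD].
Qed.

Lemma roman2_domination_numberP :
  (exists2 f, roman2_dominating f & weight f = roman2_domination_number) /\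
  (forall f, roman2_dominating f -> roman2_domination_number <= weight f).
Proof.
rewrite /roman2_domination_number; case: arg_minnP => [|f domf minf].
  exact: roman2_dominating_max.
by split; [exists f | exact: minf].
Qed.

Definition roman2_graph : Prop :=
  roman2_domination_number = 2 * domination_number.

End Domination.

Section Union.

Variables G1 G2 : sgraph.

Definition union_edge (u v : G1 + G2) : bool :=
  match u, v with
  | inl x, inl y => edge x y
  | inr x, inr y => edge x y
  | _, _ => false
  end.

Lemma union_edge_sym : symmetric union_edge.
Proof. by move=> [x|x] [y|y] //=; rewrite edge_sym. Qed.

Lemma union_edge_irrefl : irreflexive union_edge.
Proof. by move=> [x|x] /=; rewrite edge_irrefl. Qed.

Lemma union_vertex_gt0 : 0 < #|{: G1 + G2}|.
Proof. by rewrite card_sum addn_gt0 vertex_gt0. Qed.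

(* Vertex-disjointness is enforced by taking the sum of the vertex types. *)
Definition graph_union : sgraph :=
  SGraph union_edge_sym union_edge_irrefl union_vertex_gt0.

End Union.

(* Main.v *)
(* Restriction to the two summands identifies the (Roman {2}-)dominating
   objects of the union with pairs of such objects, so both domination numbers
   are additive.  As one always has roman2_domination_number <=
   2 * domination_number, equality for the sums forces equality termwise. *)
Require Import Defs.
From mathcomp Require Import all_boot.
From mathcomp Require Import zify.

Lemma forall_sumE (A B : finType) (P : pred (A + B)) :
  [forall u, P u] = [forall x, P (inl x)] && [forall y, P (inr y)].
Proof.
apply/forallP/andP => [PT|[/forallP P1 /forallP P2] [x|y]] //.
by split; apply/forallP.
Qed.

Lemma exists_sumE (A B : finType) (P : pred (A + B)) :
  [exists u, P u] = [exists x, P (inl x)] || [exists y, P (inr y)].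
Proof.
apply/existsP/orP => [[[x|y] Pu]|[] /existsP[z Pz]].
- by left; apply/existsP; exists x.
- by right; apply/existsP; exists y.
- by exists (inl z).
- by exists (inr z).
Qed.

(** Discards the half of a split quantifier that ranges over the summand not containing the vertex
    at hand, where [union_edge] is constantly false. *)
Lemma existsb_pred0 (A : finType) (P : pred A) :
  P =1 xpred0 -> [exists x, P x] = false.
Proof. by move=> P0; apply/existsP => -[x]; rewrite P0. Qed.

Lemma card_set_sum (A B : finType) (D : {set A + B}) :
  #|D| = #|inl @^-1: D| + #|inr @^-1: D|.
Proof.
rewrite -!sum1_card big_sumType.
by congr addn; apply: eq_bigl => x; rewrite inE.
Qed.

(** No edge joins the two summands, so whatever dominates a vertex lies on that vertex's own
    side. *)
Lemma dominating_union (G1 G2 : sgraph) (D : {set graph_union G1 G2}) :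
  dominating (G := graph_union G1 G2) D =
  dominating (G := G1) (inl @^-1: D) && dominating (G := G2) (inr @^-1: D).
Proof.
rewrite /dominating forall_sumE; congr andb; apply: eq_forallb => x;
  rewrite exists_sumE /= inE; congr (_ ==> _).
- rewrite [X in _ || X]existsb_pred0 => [|y]; last exact: andbF.
  by rewrite orbF; apply: eq_existsb => y; rewrite inE.
- rewrite [X in X || _]existsb_pred0 => [|y]; last exact: andbF.
  by apply: eq_existsb => y; rewrite inE.
Qed.

Lemma roman2_dominating_union (G1 G2 : sgraph)
    (f : {ffun graph_union G1 G2 -> 'I_3}) :
  roman2_dominating (G := graph_union G1 G2) f =
  roman2_dominating (G := G1) [ffun x => f (inl x)] &&
  roman2_dominating (G := G2) [ffun y => f (inr y)].
Proof.
rewrite /roman2_dominating forall_sumE; congr andb; apply: eq_forallb => v;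
  rewrite ffunE; congr (_ ==> (_ || _)); rewrite exists_sumE /=.
- by rewrite [X in _ || X]existsb_pred0 // orbF; apply: eq_existsb => u; rewrite ffunE.
(* The two neighbours of value 1 are confined to the side of [v] one after the other: first [x],
   through [edge v x], then [y], through [edge v y]. *)
- rewrite [X in _ || X]existsb_pred0 => [|x]; last first.
    by apply: existsb_pred0 => y; rewrite andbF.
  rewrite orbF; apply: eq_existsb => x; rewrite exists_sumE /=.
  rewrite [X in _ || X]existsb_pred0 => [|y]; last by rewrite !andbF.
  by rewrite orbF; apply: eq_existsb => y; rewrite !ffunE.
- by rewrite [X in X || _]existsb_pred0 //; apply: eq_existsb => u; rewrite ffunE.
- rewrite [X in X || _]existsb_pred0 => [|x]; last first.
    by apply: existsb_pred0 => y; rewrite andbF.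
  apply: eq_existsb => x; rewrite exists_sumE /=.
  rewrite [X in X || _]existsb_pred0 => [|y]; last by rewrite !andbF.
  by apply: eq_existsb => y; rewrite !ffunE.
Qed.

Lemma weight_union (G1 G2 : sgraph) (f : {ffun graph_union G1 G2 -> 'I_3}) :
  weight (G := graph_union G1 G2) f =
  weight (G := G1) [ffun x => f (inl x)] +
  weight (G := G2) [ffun y => f (inr y)].
Proof.
by rewrite /weight big_sumType; congr addn; apply: eq_bigr => x _; rewrite ffunE.
Qed.

Lemma domination_number_union (G1 G2 : sgraph) :
  domination_number (graph_union G1 G2) =
  domination_number G1 + domination_number G2.
Proof.
have [[D domD cardD] minD] := domination_numberP (graph_union G1 G2).
have [[D1 dom1 card1] min1] := domination_numberP G1.
have [[D2 dom2 card2] min2] := domination_numberP G2.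
apply/eqP; rewrite eqn_leq; apply/andP; split; last first.
  (* Lower bound: the two traces of a minimum dominating set of the union compete with the minima of
     the summands. *)
  move: domD; rewrite dominating_union -cardD card_set_sum => /andP[domD1 domD2].
  by rewrite leq_add ?min1 ?min2.
(* Upper bound: minimum dominating sets of the summands are glued together. *)
pose D' : {set graph_union G1 G2} :=
  [set u | match u with inl x => x \in D1 | inr y => y \in D2 end].
have D'1 : inl @^-1: D' = D1 by apply/setP => x; rewrite !inE.
have D'2 : inr @^-1: D' = D2 by apply/setP => y; rewrite !inE.
rewrite -card1 -card2 -D'1 -D'2 -card_set_sum.
by apply: minD; rewrite dominating_union D'1 D'2 dom1.
Qed.

Lemma roman2_domination_number_union (G1 G2 : sgraph) :
  roman2_domination_number (graph_union G1 G2) =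
  roman2_domination_number G1 + roman2_domination_number G2.
Proof.
have [[f domf wf] minf] := roman2_domination_numberP (graph_union G1 G2).
have [[f1 dom1 w1] min1] := roman2_domination_numberP G1.
have [[f2 dom2 w2] min2] := roman2_domination_numberP G2.
apply/eqP; rewrite eqn_leq; apply/andP; split; last first.
  move: domf; rewrite roman2_dominating_union -wf weight_union => /andP[domf1 domf2].
  by rewrite leq_add ?min1 ?min2.
(* Optimal functions on the summands are glued to bound the union from above. *)
pose f' : {ffun graph_union G1 G2 -> 'I_3} :=
  [ffun u => match u with inl x => f1 x | inr y => f2 y end].
have f'1 : [ffun x => f' (inl x)] = f1 by apply/ffunP => x; rewrite !ffunE.
have f'2 : [ffun y => f' (inr y)] = f2 by apply/ffunP => y; rewrite !ffunE.
rewrite -w1 -w2 -f'1 -f'2 -weight_union.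
by apply: minf; rewrite roman2_dominating_union f'1 f'2 dom1.
Qed.

Lemma roman2_domination_number_le (G : sgraph) :
  roman2_domination_number G <= 2 * domination_number G.
Proof.
have [[D /forallP domD <-] _] := domination_numberP G.
have [_ minf] := roman2_domination_numberP G.
(* In ['I_3], [ord_max] is the value 2. Each vertex outside the minimum dominating set [D] then has
   a neighbour of value 2, so the first alternative of the Roman condition always applies. *)
pose f : {ffun G -> 'I_3} := [ffun v => if v \in D then ord_max else ord0].
have <- : weight (G := G) f = 2 * #|D|.
  rewrite mulnC -sum_nat_const big_mkcond; apply: eq_bigr => v _.
  by rewrite ffunE; case: ifP.
apply: minf; apply/forallP => v; apply/implyP; rewrite ffunE.
case: ifPn => // vD _; have /existsP[u /andP[uD vu]] := implyP (domD v) vD.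
by apply/orP; left; apply/existsP; exists u; rewrite vu ffunE uD.
Qed.

Theorem theorem2p2 (G1 G2 : sgraph) :
  roman2_graph (graph_union G1 G2) <-> roman2_graph G1 /\ roman2_graph G2.
Proof.
rewrite /roman2_graph domination_number_union roman2_domination_number_union.
(* These bounds serve the forward direction; the converse just adds the two equalities. *)
have := roman2_domination_number_le G1; have := roman2_domination_number_le G2.
by lia.
Qed.
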